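(* Let $p$ be a prime number, let $C$ be a commutative ring, let $\lambda\in C$ be invertible, let $A$ be a commutative $C$-algebra, and let $Ш_C(A)$ be the free Baxter $C$-algebra on $A$ of weight $\lambda$. (1) For $n\ge1$ and $a_1\otimes\cdots\otimes a_n\in A^{\otimes n}$, $$(a_1\otimes\cdots\otimes a_n)^p\equiv\lambda^{(n-1)(p-1)}\,a_1^p\otimes\cdots\otimes a_n^p\pmod p.$$ In particular, if $\lambda=1$, then $(a_1\otimes\cdots\otimes a_n)^p\equiv a_1^p\otimes\cdots\otimes a_n^p\pmod p$. (2) Let $I$ be the Baxter ideal of $Ш_C(A)$ generated by $p$ and $\{a^p-a\mid a\in A\}$. Then $a^p\equiv a\pmod I$ for all $a\in Ш_C(A)$. (3) If $A$ has characteristic $p$ and $a^p=a$ for all $a\in A$, then $a^p=a$ for all $a\in Ш_C(A)$.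
   Context: Rings and algebras have an identity $1$. For an algebra $B$ and $a,b\in B$, $a\equiv b\pmod p$ means $a-b\in pB$; here $B=Ш_C(A)$. The free (commutative) Baxter $C$-algebra of weight $\lambda$ on a commutative $C$-algebra $A$, written $Ш_C(A)$, is realized as the mixable shuffle Baxter algebra: as a $C$-module it is $\bigoplus_{n\ge1}A^{\otimes n}$ (tensor products over $C$); its multiplication $\diamond$ is the $C$-bilinear product given recursively by $a_0\diamond(b_0\otimes b_1\otimes\cdots\otimes b_n)=a_0b_0\otimes b_1\otimes\cdots\otimes b_n$, $(a_0\otimes a_1\otimes\cdots\otimes a_m)\diamond b_0=a_0b_0\otimes a_1\otimes\cdots\otimes a_m$, and, for $m,n\ge1$, $(a_0\otimes a_1\otimes\cdots\otimes a_m)\diamond(b_0\otimes b_1\otimes\cdots\otimes b_n)=a_0b_0\otimes\big((a_1\otimes\cdots\otimes a_m)\diamond(1\otimes b_1\otimes\cdots\otimes b_n)\big)+a_0b_0\otimes\big((1\otimes a_1\otimes\cdots\otimes a_m)\diamond(b_1\otimes\cdots\otimes b_n)\big)+\lambda\,a_0b_0\otimes\big((a_1\otimes\cdots\otimes a_m)\diamond(b_1\otimes\cdots\otimes b_n)\big)$ for $a_i,b_j\in A$; its Baxter operator is $P_A(a_1\otimes\cdots\otimes a_m)=1\otimes a_1\otimes\cdots\otimes a_m$, which satisfies $P_A(u)P_A(v)=P_A(uP_A(v))+P_A(P_A(u)v)+\lambda P_A(uv)$. The identity is $1\in A=A^{\otimes1}$, and $A=A^{\otimes 1}$ is regarded as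 a subalgebra. Powers $(a_1\otimes\cdots\otimes a_n)^p$ are taken with respect to $\diamond$, while $a_i^p$ is the power in $A$. A Baxter ideal of $Ш_C(A)$ is an ideal $I$ with $P_A(I)\subseteq I$; the Baxter ideal generated by a set is the smallest Baxter ideal containing it. *)

(* Defs.v *)
From HB Require Import structures.
From mathcomp Require Import all_boot all_algebra.
From mathcomp Require Import finmap boolp.
From mathcomp Require Import monalg.

Set Implicit Arguments.
Unset Strict Implicit.
Unset Printing Implicit Defensive.

Import GRing.Theory.
Local Open Scope ring_scope.
Local Open Scope quotient_scope.

(* A commutative C-algebra is given as a commutative ring A with a ring
   morphism phi : C -> A, the scalar action being c . a = phi c * a.  We use
   comPzRingType so that the zero ring is not excluded. *)

(* ------------------------------------------------------------------------- *)
(* The C-module \bigoplus_(n >= 1) A^{\otimes n}: the free C-module on the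
   nonempty words (a_1, ..., a_n) over A, modulo multilinearity in each letter.
   All relations are between words of the same length, so this is the direct sum
   over n >= 1 of the quotients that define A^{\otimes n}. *)

(* The nonempty word a :: s is represented by the pair (a, s). *)
Definition word (A : Type) : Type := (A * seq A)%type.
HB.instance Definition _ (A : choiceType) := Choice.on (word A).

(* word_at u a v is the word u ++ a :: v. *)
Definition word_at (A : Type) (u : seq A) (a : A) (v : seq A) : word A :=
  if u is b :: u' then (b, u' ++ a :: v) else (a, v).

Section TensorSum.
Context (C A : comPzRingType) (phi : {rmorphism C -> A}).

(* << c *g w >> is the word w with coefficient c.  The coefficients c make the
   subgroup generated by these elements a C-submodule. *)
Inductive multilin_rel : {malg C[word A]} -> Prop :=
| Multilin_add c u a b v :
    multilin_rel (<< c *g word_at u (a + b) v >>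
                  - << c *g word_at u a v >> - << c *g word_at u b v >>)
| Multilin_scale c d u a v :
    multilin_rel (<< c *g word_at u (phi d * a) v >>
                  - << c * d *g word_at u a v >>)
| Multilin_zero : multilin_rel 0
| Multilin_sub g h :
    multilin_rel g -> multilin_rel h -> multilin_rel (g - h).

Definition multilin_pred : {pred {malg C[word A]}} :=
  fun g => `[< multilin_rel g >].

Fact multilin_closed : zmod_closed multilin_pred.
Proof.
split; first by apply/asboolP; exact: Multilin_zero.
by move=> g h /asboolP gP /asboolP hP; apply/asboolP; exact: Multilin_sub.
Qed.
HB.instance Definition _ :=
  GRing.isZmodClosed.Build {malg C[word A]} multilin_pred multilin_closed.

Definition tensor_sum : Type := Quotient.quot multilin_pred.
HB.instance Definition _ := GRing.Zmodule.on tensor_sum.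

Definition tensor_class (g : {malg C[word A]}) : tensor_sum :=
  \pi_(Quotient.quot multilin_pred) g.

End TensorSum.

(* The additive extension of f : C -> word A -> V, read as c w |-> f c w. *)
HB.lock Definition malg_lift (C A : comPzRingType) (V : zmodType)
  (f : C -> word A -> V) (g : {malg C[word A]}) : V :=
  \sum_(w <- msupp g) f (g@_w) w.

HB.lock Definition tensor_lift (C A : comPzRingType)
  (phi : {rmorphism C -> A}) (V : zmodType) (f : C -> word A -> V)
  (x : tensor_sum phi) : V := malg_lift f (repr x).

Section TensorSumTheory.
Context (C A : comPzRingType) (phi : {rmorphism C -> A}).
Local Notation multilin_rel := (@multilin_rel C A phi).
Local Notation multilin_pred := (multilin_pred phi).
Local Notation tensor_sum := (tensor_sum phi).
Local Notation tensor_class := (@tensor_class C A phi).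
Local Notation tensor_lift := (@tensor_lift C A phi _).

Section Lift.
Variables (V : zmodType) (f : C -> word A -> V).
Hypothesis fD : forall w c d, f (c + d) w = f c w + f d w.

Let f0 w : f 0 w = 0.
Proof. by apply: (addrI (f 0 w)); rewrite -fD !addr0. Qed.
Let fN w c : f (- c) w = - f c w.
Proof. by apply: (addrI (f c w)); rewrite -fD !subrr f0. Qed.

Lemma malg_liftEw (d : {fset word A}) g : (msupp g `<=` d)%fset ->
  malg_lift f g = \sum_(w <- d) f (g@_w) w.
Proof.
move=> le; rewrite malg_lift.unlock [LHS](big_fset_incl _ le) => //= x xd /mcoeff_outdom ->.
exact: f0.
Qed.

Lemma malg_liftU c w : malg_lift f << c *g w >> = f c w.
Proof. by rewrite (malg_liftEw msuppU_le) big_seq_fset1 mcoeffUU. Qed.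

Lemma malg_liftB g h : malg_lift f (g - h) = malg_lift f g - malg_lift f h.
Proof.
pose E := (msupp g `|` msupp h)%fset.
rewrite (@malg_liftEw E) ?msuppB_le // (@malg_liftEw E g) ?fsubsetUl //.
rewrite (@malg_liftEw E h) ?fsubsetUr // -sumrB.
by apply: eq_bigr => w _; rewrite mcoeffB fD fN.
Qed.

Hypothesis f_add : forall c u a b v,
  f c (word_at u (a + b) v) = f c (word_at u a v) + f c (word_at u b v).
Hypothesis f_scale : forall c d u a v,
  f c (word_at u (phi d * a) v) = f (c * d) (word_at u a v).

Lemma malg_lift_rel g : multilin_rel g -> malg_lift f g = 0.
Proof.
elim=> [c u a b v|c d u a v||g1 h1 _ g0 _ h0].
- by rewrite !malg_liftB !malg_liftU f_add addrAC addrK subrr.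
- by rewrite malg_liftB !malg_liftU f_scale subrr.
- by rewrite -[X in malg_lift f X](subrr 0) malg_liftB subrr.
- by rewrite malg_liftB g0 h0 subrr.
Qed.

Lemma tensor_lift_class g : tensor_lift f (tensor_class g) = malg_lift f g.
Proof.
apply/eqP; rewrite tensor_lift.unlock -subr_eq0 -malg_liftB; apply/eqP/malg_lift_rel.
have : repr (tensor_class g) == g %[mod (Quotient.quot multilin_pred)].
  by rewrite reprK.
by rewrite -Quotient.idealrBE => /asboolP.
Qed.

Lemma tensor_lift_sub x y :
  tensor_lift f (x - y) = tensor_lift f x - tensor_lift f y.
Proof.
rewrite -[x]reprK -[y]reprK -raddfB.
by rewrite !tensor_lift_class malg_liftB.
Qed.
End Lift.

Lemma tensor_classB g h :
  tensor_class (g - h) = tensor_class g - tensor_class h.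
Proof. exact: raddfB. Qed.
HB.instance Definition _ :=
  GRing.isZmodMorphism.Build _ _ tensor_class tensor_classB.

Lemma tensor_class_rel g : multilin_rel g -> tensor_class g = 0.
Proof.
move=> gP; rewrite -(raddf0 tensor_class); apply/eqP.
by rewrite -Quotient.idealrBE subr0; apply/asboolP.
Qed.

Lemma tensor_ind (Q : tensor_sum -> Prop) :
    (forall x y, Q x -> Q y -> Q (x + y)) ->
    (forall c w, Q (tensor_class << c *g w >>)) -> forall x, Q x.
Proof.
move=> QD QU x; rewrite -[x]reprK (monalgE (repr x)).
rewrite -/(tensor_class _) raddf_sum.
apply: (big_ind Q) => [|//|w _]; last exact: QU.
by have := QU 0 (0, [::]); rewrite monalgU0 raddf0.
Qed.

Lemma tensor_class_add c u a b v :
  tensor_class << c *g word_at u (a + b) v >>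
  = tensor_class << c *g word_at u a v >>
    + tensor_class << c *g word_at u b v >>.
Proof.
apply/eqP; rewrite -subr_eq0 opprD addrA -!tensor_classB.
by rewrite tensor_class_rel //; exact: Multilin_add.
Qed.

Lemma tensor_class_mulscale c d u a v :
  tensor_class << c *g word_at u (phi d * a) v >>
  = tensor_class << c * d *g word_at u a v >>.
Proof.
apply/eqP; rewrite -subr_eq0 -tensor_classB.
by rewrite tensor_class_rel //; exact: Multilin_scale.
Qed.

Definition tensor_scale (c : C) : tensor_sum -> tensor_sum :=
  tensor_lift (fun d w => tensor_class << c * d *g w >>).

Lemma tensor_scaleU c d w :
  tensor_scale c (tensor_class << d *g w >>) = tensor_class << c * d *g w >>.
Proof.
rewrite /tensor_scale tensor_lift_class ?malg_liftU //.
- by move=> w' d1 d2; rewrite mulrDr monalgUD raddfD.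
- by move=> w' d1 d2; rewrite mulrDr monalgUD raddfD.
- by move=> *; rewrite tensor_class_add.
- by move=> *; rewrite tensor_class_mulscale mulrA.
Qed.

Lemma tensor_scale_sub c x y :
  tensor_scale c (x - y) = tensor_scale c x - tensor_scale c y.
Proof.
apply: tensor_lift_sub.
- by move=> w' d1 d2; rewrite mulrDr monalgUD raddfD.
- by move=> *; rewrite tensor_class_add.
- by move=> *; rewrite tensor_class_mulscale mulrA.
Qed.
HB.instance Definition _ c :=
  GRing.isZmodMorphism.Build _ _ (tensor_scale c) (tensor_scale_sub c).

Fact tensor_scaleDr : right_distributive tensor_scale +%R.
Proof. by move=> c x y; rewrite raddfD. Qed.
Fact tensor_scaleA c d x :
  tensor_scale c (tensor_scale d x) = tensor_scale (c * d) x.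
Proof.
elim/tensor_ind: x => [x y xP yP|e w]; first by rewrite !tensor_scaleDr xP yP.
by rewrite !tensor_scaleU mulrA.
Qed.
Fact tensor_scale1 : left_id 1 tensor_scale.
Proof.
elim/tensor_ind => [x y xP yP|e w]; first by rewrite tensor_scaleDr xP yP.
by rewrite tensor_scaleU mul1r.
Qed.
Fact tensor_scaleDl x :
  {morph (fun c => tensor_scale c x) : c d / c + d}.
Proof.
move=> c d; elim/tensor_ind: x => [x y xP yP|e w].
  by rewrite !tensor_scaleDr xP yP addrACA.
by rewrite !tensor_scaleU mulrDl monalgUD raddfD.
Qed.
HB.instance Definition _ := GRing.Zmodule_isLmodule.Build C tensor_sum
  tensor_scaleA tensor_scale1 tensor_scaleDr tensor_scaleDl.

(* a_1 \otimes ... \otimes a_n for w = (a_1, [:: a_2; ...; a_n]). *)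
Definition word_tensor (w : word A) : tensor_sum := tensor_class << 1 *g w >>.

(* a_1 \otimes ... \otimes a_n for s = [:: a_1; ...; a_n] with n >= 1; the
   value at the empty sequence is a dummy. *)
Definition tensor (s : seq A) : tensor_sum :=
  if s is a :: s' then word_tensor (a, s') else 0.

Lemma tensor_classU c w : tensor_class << c *g w >> = c *: word_tensor w.
Proof. by rewrite [RHS]tensor_scaleU mulr1. Qed.

Definition multilinear (V : lmodType C) (g : word A -> V) : Prop :=
  (forall u a b v,
     g (word_at u (a + b) v) = g (word_at u a v) + g (word_at u b v)) /\
  (forall c u a v, g (word_at u (phi c * a) v) = c *: g (word_at u a v)).

Lemma word_tensor_multilinear : multilinear word_tensor.
Proof.
split=> [u a b v|c u a v]; first exact: tensor_class_add.
by rewrite /word_tensor tensor_class_mulscale mul1r tensor_classU.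
Qed.

(* The linear extension of a multilinear g. *)
Definition tensor_linext (V : lmodType C) (g : word A -> V) :
  tensor_sum -> V := tensor_lift (fun c w => c *: g w).

Section LinExt.
Variables (V : lmodType C) (g : word A -> V).
Hypothesis gP : multilinear g.

Let fD w c d : (c + d) *: g w = c *: g w + d *: g w.
Proof. exact: scalerDl. Qed.
Let f_add c u a b v : c *: g (word_at u (a + b) v)
  = c *: g (word_at u a v) + c *: g (word_at u b v).
Proof. by rewrite gP.1 scalerDr. Qed.
Let f_scale c d u a v :
  c *: g (word_at u (phi d * a) v) = (c * d) *: g (word_at u a v).
Proof. by rewrite gP.2 scalerA. Qed.

Lemma tensor_linextU c w :
  tensor_linext g (tensor_class << c *g w >>) = c *: g w.
Proof. by rewrite /tensor_linext tensor_lift_class // malg_liftU. Qed.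

Lemma tensor_linextE w : tensor_linext g (word_tensor w) = g w.
Proof. by rewrite tensor_linextU scale1r. Qed.

Lemma tensor_linextD x y :
  tensor_linext g (x + y) = tensor_linext g x + tensor_linext g y.
Proof.
have lB := tensor_lift_sub fD f_add f_scale.
have l0 : tensor_linext g 0 = 0 by rewrite -(subrr 0) [LHS]lB subrr.
have lN z : tensor_linext g (- z) = - tensor_linext g z.
  by rewrite -sub0r [LHS]lB -/(tensor_linext g 0) l0 sub0r.
by rewrite -{1}[y]opprK [LHS]lB -!/(tensor_linext g _) lN opprK.
Qed.

Lemma tensor_linextZ c x : tensor_linext g (c *: x) = c *: tensor_linext g x.
Proof.
elim/tensor_ind: x => [x y xP yP|d w].
  by rewrite scalerDr !tensor_linextD xP yP scalerDr.
by rewrite [c *: _]tensor_scaleU !tensor_linextU scalerA.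
Qed.

Lemma tensor_linext_linear : linear (tensor_linext g).
Proof. by move=> c x y; rewrite tensor_linextD tensor_linextZ. Qed.
End LinExt.

Lemma tensor_wind (Q : tensor_sum -> Prop) :
    (forall x y, Q x -> Q y -> Q (x + y)) ->
    (forall c x, Q x -> Q (c *: x)) ->
    (forall w, Q (word_tensor w)) -> forall x, Q x.
Proof.
move=> QD QZ QU; elim/tensor_ind => // c w.
by rewrite tensor_classU; apply: QZ.
Qed.

(* The universal property of \bigoplus_(n >= 1) A^{\otimes n}. *)
Theorem tensor_sum_universal (V : lmodType C) (g : word A -> V) :
  multilinear g ->
  exists2 h : {linear tensor_sum -> V},
    forall w, h (word_tensor w) = g w
  & forall h' : {linear tensor_sum -> V},
      (forall w, h' (word_tensor w) = g w) -> h' =1 h.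
Proof.
move=> gP.
pose H := GRing.isLinear.Build _ _ _ _ _ (tensor_linext_linear gP).
pose h : {linear tensor_sum -> V} := HB.pack (tensor_linext g) H.
exists h => [w|h' h'P]; first exact: tensor_linextE.
elim/tensor_wind => [x y xP yP|c x xP|w].
- by rewrite !linearD xP yP.
- by rewrite !linearZ xP.
- by rewrite h'P [RHS]tensor_linextE.
Qed.

(* x |-> a \otimes x. *)
Definition tensor_cons (a : A) : tensor_sum -> tensor_sum :=
  tensor_linext (fun w => word_tensor (a, w.1 :: w.2)).

Lemma word_at_cons (b : A) u a v :
  (b, (word_at u a v).1 :: (word_at u a v).2) = word_at (b :: u) a v.
Proof. by case: u. Qed.

Lemma tensor_cons_multilinear b :
  multilinear (fun w => word_tensor (b, w.1 :: w.2)).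
Proof.
split=> *; rewrite !word_at_cons; first exact: word_tensor_multilinear.1.
exact: word_tensor_multilinear.2.
Qed.

Lemma tensor_cons_linear a : linear (tensor_cons a).
Proof. exact: tensor_linext_linear (tensor_cons_multilinear a). Qed.
HB.instance Definition _ a :=
  GRing.isLinear.Build _ _ _ _ (tensor_cons a) (tensor_cons_linear a).

Lemma tensor_consE a w :
  tensor_cons a (word_tensor w) = word_tensor (a, w.1 :: w.2).
Proof. exact: tensor_linextE (tensor_cons_multilinear a) w. Qed.

Lemma tensor_consD a x y :
  tensor_cons a (x + y) = tensor_cons a x + tensor_cons a y.
Proof. exact: linearD. Qed.
Lemma tensor_consZ a c x : tensor_cons a (c *: x) = c *: tensor_cons a x.
Proof. exact: linearZ. Qed.

Lemma tensor_cons_addl a b x :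
  tensor_cons (a + b) x = tensor_cons a x + tensor_cons b x.
Proof.
elim/tensor_wind: x => [x y xP yP|c x xP|[d s]].
- by rewrite !tensor_consD xP yP addrACA.
- by rewrite !tensor_consZ xP scalerDr.
- by rewrite !tensor_consE (word_tensor_multilinear.1 [::]).
Qed.

Lemma tensor_cons_scalel c a x :
  tensor_cons (phi c * a) x = c *: tensor_cons a x.
Proof.
elim/tensor_wind: x => [x y xP yP|d x xP|[d s]].
- by rewrite !tensor_consD xP yP scalerDr.
- by rewrite !tensor_consZ xP !scalerA mulrC.
- by rewrite !tensor_consE (word_tensor_multilinear.2 _ [::]).
Qed.
End TensorSumTheory.

(* ------------------------------------------------------------------------- *)
(* The mixable shuffle Baxter algebra of weight lambda. *)

(* lambda is a phantom parameter of the carrier: it selects the product. *)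
Definition sha (C A : comPzRingType) (phi : {rmorphism C -> A}) (lambda : C)
  : Type := tensor_sum phi.

Section Mixable.
Context (C A : comPzRingType) (phi : {rmorphism C -> A}) (lambda : C).
Local Notation sha := (sha phi lambda).

HB.instance Definition _ := GRing.Lmodule.on sha.

Local Notation cons := (tensor_cons (phi := phi)).
Local Notation wt := (word_tensor phi).

(* sha_tails s t a0 b0 is the product of (a0, s) and (b0, t). *)
Fixpoint sha_tails (s : seq A) : seq A -> A -> A -> sha :=
  fix inner (t : seq A) (a0 b0 : A) : sha :=
    match s, t with
    | [::], _ => wt (a0 * b0, t)
    | _, [::] => wt (a0 * b0, s)
    | a1 :: s', b1 :: t' =>
        cons (a0 * b0) (sha_tails s' t a1 1)
        + cons (a0 * b0) (inner t' 1 b1)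
        + lambda *: cons (a0 * b0) (sha_tails s' t' a1 b1)
    end.

Definition sha_word_mul (w w' : word A) : sha := sha_tails w.2 w'.2 w.1 w'.1.

Lemma sha_word_mul1l a0 (w : word A) :
  sha_word_mul (a0, [::]) w = wt (a0 * w.1, w.2).
Proof. by case: w => b0 []. Qed.
Lemma sha_word_mul1r (w : word A) b0 :
  sha_word_mul w (b0, [::]) = wt (w.1 * b0, w.2).
Proof. by case: w => a0 []. Qed.
Lemma sha_word_mulE a0 b0 (w w' : word A) :
  sha_word_mul (a0, w.1 :: w.2) (b0, w'.1 :: w'.2) =
    cons (a0 * b0) (sha_word_mul w (1, w'.1 :: w'.2))
    + cons (a0 * b0) (sha_word_mul (1, w.1 :: w.2) w')
    + lambda *: cons (a0 * b0) (sha_word_mul w w').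
Proof. by []. Qed.

(* The bilinear extension of sha_word_mul. *)
Definition sha_mul (x y : sha) : sha :=
  tensor_linext (fun w => tensor_linext (sha_word_mul w) y) x.
Definition sha_one : sha := wt (1, [::]).

Lemma sha_word_mulC w w' : sha_word_mul w w' = sha_word_mul w' w.
Proof.
have [n] := ubnP (size w.2 + size w'.2).
elim: n w w' => // n IHn [a0 s] [b0 t] /=.
case: s => [|a1 s] lt_n; first by rewrite sha_word_mul1l sha_word_mul1r mulrC.
case: t lt_n => [|b1 t] lt_n.
  by rewrite sha_word_mul1l sha_word_mul1r mulrC.
rewrite (sha_word_mulE a0 b0 (a1, s) (b1, t)).
rewrite (sha_word_mulE b0 a0 (b1, t) (a1, s)) /=.
rewrite /= !addSn !addnS !ltnS in lt_n.
rewrite (IHn (a1, s)) /= ?addnS //.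
rewrite (IHn (1, a1 :: s)) /= ?addSn //.
rewrite (IHn (a1, s)) /= ?(ltnW lt_n) // (mulrC a0).
by rewrite [X in X + _]addrC.
Qed.

Lemma sha_word_mul_multilinear w' : multilinear phi (sha_word_mul^~ w').
Proof.
have [wA wZ] := word_tensor_multilinear phi.
split=> [u a b v|c u a v].
  have [n] := ubnP (size u + size v + size w'.2).
  elim: n u v w' => // n IHn [|a0 u] v [b0 [|b1 t]] /= lt_n.
  - by rewrite !sha_word_mul1r /= mulrDl (wA [::]).
  - case: v lt_n => [|a1 v] _.
      by rewrite !sha_word_mul1l /= mulrDl (wA [::]).
    rewrite !(sha_word_mulE _ b0 (a1, v) (b1, t)) /= mulrDl !tensor_cons_addl.
    by rewrite scalerDr [X in X + _ = _]addrACA [LHS]addrACA.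
  - by rewrite !sha_word_mul1r /= (wA (a0 * b0 :: u)).
  - have Ew d : (a0, u ++ d :: v)
        = (a0, (word_at u d v).1 :: (word_at u d v).2).
      by rewrite word_at_cons.
    have Ew1 d : (1, (word_at u d v).1 :: (word_at u d v).2)
        = word_at (1 :: u) d v by rewrite word_at_cons.
    rewrite !Ew !(sha_word_mulE a0 b0 _ (b1, t)) /= !Ew1.
    rewrite ltnS addSn in lt_n.
    rewrite !IHn ?(leq_trans _ lt_n) //= ?addnS ?addSn ?ltnS ?leqnn //.
    rewrite !tensor_consD scalerDr.
    by rewrite [X in X + _ = _]addrACA [LHS]addrACA.
have [n] := ubnP (size u + size v + size w'.2).
elim: n u v w' => // n IHn [|a0 u] v [b0 [|b1 t]] /= lt_n.
- by rewrite !sha_word_mul1r /= -mulrA (wZ _ [::]).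
- case: v lt_n => [|a1 v] _.
    by rewrite !sha_word_mul1l /= -mulrA (wZ _ [::]).
  rewrite !(sha_word_mulE _ b0 (a1, v) (b1, t)) /= -mulrA !tensor_cons_scalel.
  by rewrite !scalerDr !scalerA [lambda * c]mulrC.
- by rewrite !sha_word_mul1r /= (wZ _ (a0 * b0 :: u)).
- have Ew d : (a0, u ++ d :: v)
      = (a0, (word_at u d v).1 :: (word_at u d v).2).
    by rewrite word_at_cons.
  have Ew1 d : (1, (word_at u d v).1 :: (word_at u d v).2)
      = word_at (1 :: u) d v by rewrite word_at_cons.
  rewrite !Ew !(sha_word_mulE a0 b0 _ (b1, t)) /= !Ew1.
  rewrite ltnS addSn in lt_n.
  rewrite !IHn ?(leq_trans _ lt_n) //= ?addnS ?addSn ?ltnS ?leqnn //.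
  by rewrite !tensor_consZ !scalerDr !scalerA [lambda * c]mulrC.
Qed.

Lemma sha_mul_multilinear (y : sha) :
  multilinear phi (fun w => tensor_linext (sha_word_mul w) y).
Proof.
have mw w : multilinear phi (sha_word_mul w).
  have [mA mZ] := sha_word_mul_multilinear w.
  by split=> *; rewrite ![sha_word_mul w _]sha_word_mulC ?mA ?mZ.
split=> [u a b v|c u a v]; elim/tensor_wind: y => [x y xP yP|d x xP|w].
- by rewrite !tensor_linextD // xP yP addrACA.
- by rewrite !tensor_linextZ // xP scalerDr.
- by rewrite !tensor_linextE // (sha_word_mul_multilinear w).1.
- by rewrite !tensor_linextD // xP yP scalerDr.
- by rewrite !tensor_linextZ // xP !scalerA mulrC.
- by rewrite !tensor_linextE // (sha_word_mul_multilinear w).2.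
Qed.

Lemma sha_mulE w w' : sha_mul (wt w) (wt w') = sha_word_mul w w'.
Proof.
rewrite /sha_mul (tensor_linextE (sha_mul_multilinear _)) tensor_linextE //.
have [mA mZ] := sha_word_mul_multilinear w.
by split=> *; rewrite ![sha_word_mul w _]sha_word_mulC ?mA ?mZ.
Qed.

Lemma sha_mulDl : left_distributive sha_mul +%R.
Proof. by move=> x y z; exact: (tensor_linextD (sha_mul_multilinear z)). Qed.

Lemma sha_scaleAl c x y : c *: sha_mul x y = sha_mul (c *: x) y.
Proof. by rewrite /sha_mul (tensor_linextZ (sha_mul_multilinear y)). Qed.

Lemma sha_wmulDr w x y :
  sha_mul (wt w) (x + y) = sha_mul (wt w) x + sha_mul (wt w) y.
Proof.
have [mA mZ] := sha_word_mul_multilinear w.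
rewrite /sha_mul !(tensor_linextE (sha_mul_multilinear _)) tensor_linextD //.
by split=> *; rewrite ![sha_word_mul w _]sha_word_mulC ?mA ?mZ.
Qed.

Lemma sha_wmulZr w c x : sha_mul (wt w) (c *: x) = c *: sha_mul (wt w) x.
Proof.
have [mA mZ] := sha_word_mul_multilinear w.
rewrite /sha_mul !(tensor_linextE (sha_mul_multilinear _)) tensor_linextZ //.
by split=> *; rewrite ![sha_word_mul w _]sha_word_mulC ?mA ?mZ.
Qed.

Fact sha_mulC : commutative sha_mul.
Proof.
move=> x y; elim/tensor_wind: x => [x1 x2 x1P x2P|c x xP|w].
- rewrite sha_mulDl x1P x2P.
  elim/tensor_wind: y {x1P x2P} => [y1 y2 y1P y2P|c y yP|w].
  + by rewrite !sha_mulDl -y1P -y2P addrACA.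
  + by rewrite -!sha_scaleAl -yP scalerDr.
  + by rewrite sha_wmulDr.
- rewrite -sha_scaleAl xP.
  elim/tensor_wind: y {xP} => [y1 y2 y1P y2P|d y yP|w].
  + by rewrite !sha_mulDl scalerDr y1P y2P.
  + by rewrite -!sha_scaleAl -yP !scalerA mulrC.
  + by rewrite sha_wmulZr.
- elim/tensor_wind: y => [y1 y2 y1P y2P|d y yP|w'].
  + by rewrite sha_mulDl sha_wmulDr y1P y2P.
  + by rewrite -sha_scaleAl sha_wmulZr yP.
  + by rewrite !sha_mulE sha_word_mulC.
Qed.

Lemma sha_mulDr : right_distributive sha_mul +%R.
Proof. by move=> x y z; rewrite ![sha_mul x _]sha_mulC sha_mulDl. Qed.
Lemma sha_scaleAr c x y : c *: sha_mul x y = sha_mul x (c *: y).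
Proof. by rewrite ![sha_mul x _]sha_mulC sha_scaleAl. Qed.

Fact sha_mul1 : left_id sha_one sha_mul.
Proof.
elim/tensor_wind => [x y xP yP|c x xP|[a s]].
- by rewrite sha_mulDr xP yP.
- by rewrite -sha_scaleAr xP.
- by rewrite sha_mulE sha_word_mul1l mul1r.
Qed.

(* (a \otimes x) (b \otimes y) for arbitrary x and y, not only for tensors *)
Lemma sha_mul_cons a b x y :
  sha_mul (cons a x) (cons b y) =
    cons (a * b) (sha_mul x (cons 1 y)) + cons (a * b) (sha_mul (cons 1 x) y)
    + lambda *: cons (a * b) (sha_mul x y).
Proof.
elim/tensor_wind: x => [x1 x2 x1P x2P|c x xP|w].
- rewrite !tensor_consD !sha_mulDl x1P x2P !tensor_consD scalerDr.
  by rewrite [X in _ = X + _]addrACA [RHS]addrACA.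
- rewrite !tensor_consZ -!sha_scaleAl xP !tensor_consZ !scalerDr !scalerA.
  by rewrite [lambda * c]mulrC.
elim/tensor_wind: y => [x1 x2 x1P x2P|c x xP|w'].
- rewrite !tensor_consD !sha_mulDr x1P x2P !tensor_consD scalerDr.
  by rewrite [X in _ = X + _]addrACA [RHS]addrACA.
- rewrite !tensor_consZ -!sha_scaleAr xP !tensor_consZ !scalerDr !scalerA.
  by rewrite [lambda * c]mulrC.
by rewrite !tensor_consE !sha_mulE sha_word_mulE.
Qed.

(* Multiplication by a on the first factor. *)
Lemma sha_mul1_cons a b x :
  sha_mul (wt (a, [::])) (cons b x) = cons (a * b) x.
Proof.
elim/tensor_wind: x => [x y xP yP|c x xP|w].
- by rewrite !tensor_consD sha_mulDr xP yP.
- by rewrite !tensor_consZ -sha_scaleAr xP.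
- by rewrite !tensor_consE sha_mulE sha_word_mul1l.
Qed.

Lemma sha_mul1A a x y : sha_mul (wt (a, [::])) (sha_mul x y)
  = sha_mul (sha_mul (wt (a, [::])) x) y.
Proof.
elim/tensor_wind: x => [x1 x2 x1P x2P|c x xP|[b s]].
- by rewrite sha_mulDl !sha_mulDr x1P x2P sha_mulDl.
- by rewrite -!(sha_scaleAl, sha_scaleAr) xP.
elim/tensor_wind: y => [y1 y2 y1P y2P|c y yP|[d t]].
- by rewrite !sha_mulDr y1P y2P.
- by rewrite -!sha_scaleAr yP.
rewrite (sha_mulE (a, _)) sha_word_mul1l !sha_mulE /=.
case: s => [|b1 s]; first by rewrite !sha_word_mul1l sha_mulE
  sha_word_mul1l mulrA.
case: t => [|d1 t]; first by rewrite !sha_word_mul1r sha_mulE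
  sha_word_mul1l mulrA.
rewrite !(sha_word_mulE _ d (b1, s) (d1, t)) !sha_mulDr -sha_scaleAr.
by rewrite !sha_mul1_cons mulrA.
Qed.

Fact sha_mulA : associative sha_mul.
Proof.
move=> x y z; elim/tensor_wind: x => [x1 x2 x1P x2P|c x xP|w1].
- by rewrite !sha_mulDl x1P x2P.
- by rewrite -!sha_scaleAl xP.
elim/tensor_wind: y => [y1 y2 y1P y2P|c y yP|w2].
- by rewrite !(sha_mulDl, sha_mulDr) y1P y2P.
- by rewrite -!(sha_scaleAl, sha_scaleAr) yP.
elim/tensor_wind: z => [z1 z2 z1P z2P|c z zP|w3].
- by rewrite !sha_mulDr z1P z2P.
- by rewrite -!sha_scaleAr zP.
have [n] := ubnP (size w1.2 + size w2.2 + size w3.2).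
elim: n w1 w2 w3 => // n IHn [a s] [b t] [c r] /= lt_n.
case: s lt_n => [|a1 s] lt_n; first by rewrite sha_mul1A.
case: t lt_n => [|b1 t] lt_n.
  rewrite [LHS]sha_mulC [sha_mul (wt (a, _)) (wt (b, _))]sha_mulC -!sha_mul1A.
  by rewrite [sha_mul (wt (c, r)) _]sha_mulC.
case: r lt_n => [|c1 r] lt_n.
  rewrite [RHS]sha_mulC [LHS]sha_mulC.
  rewrite [sha_mul (wt (b, _)) (wt (c, _))]sha_mulC -sha_mul1A.
  by rewrite [sha_mul (wt (b, _)) _]sha_mulC.
have E d d1 u : wt (d, d1 :: u) = cons d (wt (d1, u)) by rewrite tensor_consE.
have P1 x y : cons 1 (sha_mul x (cons 1 y) + sha_mul (cons 1 x) y
    + lambda *: sha_mul x y) = sha_mul (cons 1 x) (cons 1 y).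
  by rewrite sha_mul_cons mulr1 !(tensor_consD, tensor_consZ).
have Pl d e x y : sha_mul (cons d x) (cons e y) = cons (d * e)
    (sha_mul x (cons 1 y) + sha_mul (cons 1 x) y + lambda *: sha_mul x y).
  by rewrite sha_mul_cons !(tensor_consD, tensor_consZ).
rewrite !E !Pl mulrA; congr (cons _ _); rewrite !P1.
rewrite !(sha_mulDl, sha_mulDr) -!(sha_scaleAl, sha_scaleAr) !scalerDr.
have {}lt_n : ((size s + size t + size r).+2 < n)%N.
  by move: lt_n; rewrite /= !(addSn, addnS) ltnS.
rewrite -!E !IHn /= ?(addSn, addnS) ?lt_n
  ?(ltnW lt_n) ?(ltnW (ltnW lt_n)) //.
by rewrite +%R.[AC (1 * 3 * 3) (1 * 2 * 5 * 3 * (6 * 4 * 7))].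
Qed.

HB.instance Definition _ := GRing.Zmodule_isComPzRing.Build sha
  sha_mulA sha_mulC sha_mul1 sha_mulDl.

Lemma sha_scalerAl c (x y : sha) : c *: (x * y) = (c *: x) * y.
Proof. exact: sha_scaleAl. Qed.

(* The pure tensor a_1 \otimes ... \otimes a_n for s = [:: a_1; ...; a_n]. *)
Definition sha_tensor (s : seq A) : sha := tensor phi s.

(* A as the subalgebra A^{\otimes 1}. *)
Definition sha_in (a : A) : sha := sha_tensor [:: a].

Definition sha_baxter (x : sha) : sha := cons 1 x.

Lemma sha_tensorM1l a0 b0 t :
  sha_tensor [:: a0] * sha_tensor (b0 :: t) = sha_tensor (a0 * b0 :: t).
Proof. by rewrite [LHS]sha_mulE sha_word_mul1l. Qed.

Lemma sha_tensorM1r a0 s b0 :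
  sha_tensor (a0 :: s) * sha_tensor [:: b0] = sha_tensor (a0 * b0 :: s).
Proof. by rewrite [LHS]sha_mulE sha_word_mul1r. Qed.

Lemma sha_tensorM a0 a1 s b0 b1 t :
  sha_tensor [:: a0, a1 & s] * sha_tensor [:: b0, b1 & t] =
    cons (a0 * b0) (sha_tensor (a1 :: s) * sha_tensor [:: 1, b1 & t])
    + cons (a0 * b0) (sha_tensor [:: 1, a1 & s] * sha_tensor (b1 :: t))
    + lambda *: cons (a0 * b0) (sha_tensor (a1 :: s) * sha_tensor (b1 :: t))
    :> sha.
Proof.
rewrite [LHS]sha_mulE (sha_word_mulE a0 b0 (a1, s) (b1, t)) /=.
by rewrite -!sha_mulE.
Qed.

Lemma sha_baxter_tensor a s :
  sha_baxter (sha_tensor (a :: s)) = sha_tensor [:: 1, a & s].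
Proof. exact: tensor_consE. Qed.

Fact sha_baxter_is_linear : linear sha_baxter.
Proof. exact: tensor_cons_linear. Qed.
HB.instance Definition _ :=
  GRing.isLinear.Build C sha sha _ sha_baxter sha_baxter_is_linear.

Lemma sha_baxterM x y :
  sha_baxter x * sha_baxter y = sha_baxter (x * sha_baxter y)
    + sha_baxter (sha_baxter x * y) + lambda *: sha_baxter (x * y).
Proof. by rewrite [LHS]sha_mul_cons mulr1. Qed.

Fact sha_in_sub a b : sha_in (a - b) = sha_in a - sha_in b.
Proof.
have D c d : sha_in (c + d) = sha_in c + sha_in d.
  exact: (word_tensor_multilinear phi).1 [::] c d [::].
by apply/eqP; rewrite eq_sym subr_eq -D subrK.
Qed.
Fact sha_in_monoid : monoid_morphism sha_in.
Proof. by split=> // a b; rewrite [RHS]sha_tensorM1l. Qed.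
HB.instance Definition _ := GRing.isZmodMorphism.Build A sha sha_in sha_in_sub.
HB.instance Definition _ :=
  GRing.isMonoidMorphism.Build A sha sha_in sha_in_monoid.

Lemma sha_in_scale c a : sha_in (phi c * a) = c *: sha_in a.
Proof. exact: (word_tensor_multilinear phi).2 c [::] a [::]. Qed.

Definition baxter_ideal (I : sha -> Prop) : Prop :=
  [/\ I 0, (forall x y, I x -> I y -> I (x + y)),
      (forall r x, I x -> I (r * x))
    & (forall x, I x -> I (sha_baxter x))].

(* The Baxter ideal generated by S. *)
Definition baxter_ideal_gen (S : sha -> Prop) (x : sha) : Prop :=
  forall I : sha -> Prop,
    baxter_ideal I -> (forall s, S s -> I s) -> I x.

Lemma baxter_ideal_genP S : baxter_ideal (baxter_ideal_gen S).
Proof.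
split=> [I [] //|x y xI yI I IP SI|r x xI I IP SI|x xI I IP SI];
  case: (IP) => _ ID IM IB.
- by apply: ID; [exact: xI|exact: yI].
- by apply: IM; exact: xI.
- by apply: IB; exact: xI.
Qed.

Lemma baxter_ideal_gen_sub S s : S s -> baxter_ideal_gen S s.
Proof. by move=> Ss I _; apply. Qed.

End Mixable.

(* x and y are congruent modulo p B. *)
Definition eq_modp (B : pzRingType) (p : nat) (x y : B) : Prop :=
  exists z : B, x - y = p%:R * z.

Definition has_characteristic (R : pzRingType) (p : nat) : Prop :=
  forall n : nat, n%:R = 0 :> R <-> (p %| n)%N.

(* Main.v *)
(* Let P be a Baxter operator of weight lambda and R x = lambda x + P x.  Both
   P and R turn the product x P(y) + P(x) y + lambda x y into the product of
   the algebra, so the n-th power y of x for this new product satisfies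
   P y = (P x)^n and lambda y = (R x)^n - (P x)^n.  For n = p the Frobenius
   congruence gives lambda y = lambda^p x^p modulo p, whence
   (P x)^p = lambda^(p-1) P(x^p) modulo p when lambda is invertible.  As
   a \otimes x = a P(x), (1) follows by induction on the length of tensors.
   So does (2): modulo I, the Frobenius map is additive and lambda^(p-1) acts
   as 1, because lambda^p = lambda there.  In (3) the zero ideal is a Baxter
   ideal that contains the generators of I. *)

Require Import Defs.
From mathcomp Require Import all_boot all_algebra.
From mathcomp Require Import ring.

Set Implicit Arguments.
Unset Strict Implicit.
Unset Printing Implicit Defensive.

Import GRing.Theory.
Local Open Scope ring_scope.

Lemma eq_modp_refl (B : pzRingType) p (x : B) : eq_modp p x x.
Proof. by exists 0; rewrite subrr mulr0. Qed.

Lemma eq_modp_trans (B : pzRingType) p (y x z : B) :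
  eq_modp p x y -> eq_modp p y z -> eq_modp p x z.
Proof. by move=> [u xy] [v yz]; exists (u + v); rewrite mulrDr -xy -yz subrKA. Qed.

Lemma eq_modpM2l (B : comPzRingType) p (z x y : B) :
  eq_modp p x y -> eq_modp p (z * x) (z * y).
Proof. by move=> [u xy]; exists (z * u); rewrite -mulrBr xy mulrCA. Qed.

Lemma eq_modp_exprD (B : comPzRingType) p (x y : B) :
  prime p -> eq_modp p ((x + y) ^+ p) (x ^+ p + y ^+ p).
Proof.
move=> p_pr; case: p p_pr => // p p_pr.
(* The prime is now [p.+1], and [lift ord0 i] is i + 1. The witness collects the interior binomial
   terms, whose coefficients the prime divides. *)
exists (\sum_(i < p) x ^+ (p.+1 - lift ord0 i) * y ^+ lift ord0 i
          *+ ('C(p.+1, lift ord0 i) %/ p.+1)).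
rewrite exprDn big_ord_recl big_ord_recr /= subn0 expr0 mulr1 bin0 mulr1n.
rewrite /bump add1n subnn expr0 mul1r binn mulr1n opprD addrACA subrr add0r addrK.
rewrite mulr_sumr; apply: eq_bigr => i _.
rewrite mulr_natl -mulrnA divnK // prime_dvd_bin //=.
by rewrite /bump add1n ltnS ltn_ord.
Qed.

Section Sha.
Context (C A : comPzRingType) (phi : {rmorphism C -> A}) (lambda : C).
Local Notation sha := (sha phi lambda).
Local Notation sha_in := (sha_in phi lambda).
Local Notation sha_tensor := (sha_tensor phi lambda).

(** Turns scalars into ring elements, so that [ring] and the morphism lemmas apply to them. *)
Lemma sha_scaleE c (x : sha) : c *: x = sha_in (phi c) * x.
Proof.
by rewrite -[phi c]mulr1 sha_in_scale rmorph1 -sha_scalerAl mul1r.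
Qed.

Lemma sha_exprZ c (x : sha) n : (c *: x) ^+ n = c ^+ n *: x ^+ n.
Proof. by rewrite !sha_scaleE exprMn !rmorphXn. Qed.

Lemma sha_tensor_cons a b s :
  sha_tensor [:: a, b & s] = sha_in a * sha_baxter (sha_tensor (b :: s)).
Proof. by rewrite sha_baxter_tensor sha_tensorM1l mulr1. Qed.

Lemma sha_baxter_expr (x : sha) n :
  exists2 y : sha, sha_baxter y = sha_baxter x ^+ n.+1
    & lambda *: y = (lambda *: x + sha_baxter x) ^+ n.+1 - sha_baxter x ^+ n.+1.
Proof.
elim: n => [|n [y Py yE]]; first by exists x; rewrite ?addrK.
exists (x * sha_baxter y + sha_baxter x * y + lambda *: (x * y)).
  by rewrite !linearD linearZ /= -sha_baxterM Py -exprS.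
rewrite !sha_scaleE in yE *; set l := sha_in _ in yE *.
(* Regrouped so that [y] occurs only in P y and lambda y, which the induction hypothesis gives. *)
have -> : l * (x * sha_baxter y + sha_baxter x * y + l * (x * y))
    = l * x * sha_baxter y + (l * x + sha_baxter x) * (l * y) by ring.
rewrite Py yE !exprS; ring.
Qed.

Lemma eq_modp_scale p c (x y : sha) :
  eq_modp p x y -> eq_modp p (c *: x) (c *: y).
Proof. by rewrite !sha_scaleE; exact: eq_modpM2l. Qed.

Lemma eq_modp_baxter p (x y : sha) :
  eq_modp p x y -> eq_modp p (sha_baxter x) (sha_baxter y).
Proof.
move=> [z xy]; exists (sha_baxter z).
by rewrite -linearB xy !mulr_natl linearMn.
Qed.

Section Prime.
Context (p : nat) (p_pr : prime p).
Context (mu : C) (lambdaK : lambda * mu = 1).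

Lemma sha_baxter_frobenius (x : sha) :
  eq_modp p (sha_baxter x ^+ p) (lambda ^+ (p - 1) *: sha_baxter (x ^+ p)).
Proof.
have p_gt0 := prime_gt0 p_pr.
have [y Py yE] := sha_baxter_expr x p.-1.
rewrite prednK // in Py yE.
rewrite -Py -linearZ; apply: eq_modp_baxter.
(* Cancelling lambda through its inverse [mu] leaves lambda y to be compared with (lambda x)^p. *)
have E z : mu *: (lambda *: z) = z :> sha by rewrite scalerA mulrC lambdaK scale1r.
rewrite -[y]E -[_ *: x ^+ p]E; apply: eq_modp_scale.
rewrite yE scalerA -exprS subn1 prednK // -sha_exprZ.
have [z zE] := eq_modp_exprD (lambda *: x) (sha_baxter x) p_pr.
by exists z; rewrite -zE opprD addrA [RHS]addrAC.
Qed.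

(** Each letter of [s] costs one application of P, hence one factor lambda^(p-1). *)
Lemma sha_tensor_frobenius a s :
  eq_modp p (sha_tensor (a :: s) ^+ p)
    (lambda ^+ (size s * (p - 1)) *: sha_tensor [seq x ^+ p | x <- a :: s]).
Proof.
elim: s a => [|b s IHs] a.
  have -> : sha_tensor [seq x ^+ p | x <- [:: a]] = sha_tensor [:: a] ^+ p.
    exact: rmorphXn sha_in p a.
  by rewrite expr0 scale1r; exact: eq_modp_refl.
rewrite !map_cons !sha_tensor_cons exprMn -rmorphXn.
rewrite sha_scaleE mulrCA -sha_scaleE.
apply: eq_modpM2l; apply: eq_modp_trans (sha_baxter_frobenius _) _.
rewrite mulSn exprD -scalerA; apply: eq_modp_scale.
by rewrite -linearZ; exact: eq_modp_baxter (IHs b).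
Qed.

(** Stated for an arbitrary Baxter ideal, to serve both the generated ideal and the zero ideal. *)
Lemma sha_expr_baxter_ideal (I : sha -> Prop) : baxter_ideal I -> I p%:R ->
  (forall a, I (sha_in (a ^+ p - a))) -> forall x, I (x ^+ p - x).
Proof.
move=> [_ ID IM IB] Ip Ia.
have Ic x y : eq_modp p x y -> I (x - y) by move=> [z ->]; rewrite mulrC; apply: IM.
have Iin a : I (sha_in a ^+ p - sha_in a) by have := Ia a; rewrite rmorphB rmorphXn.
have IMx x y : I (x ^+ p - x) -> I (y ^+ p - y) -> I ((x * y) ^+ p - x * y).
  (* (xy)^p - xy = y^p (x^p - x) + x (y^p - y). *)
  move=> /(IM (y ^+ p)) xI /(IM x) yI; move: (ID _ _ xI yI).
  by congr I; rewrite exprMn; ring.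
have IDx x y : I (x ^+ p - x) -> I (y ^+ p - y) -> I ((x + y) ^+ p - (x + y)).
  move=> xI yI; move: (ID _ _ (Ic _ _ (eq_modp_exprD x y p_pr)) (ID _ _ xI yI)).
  by congr I; ring.
have Ilam x : I (lambda ^+ (p - 1) *: x - x).
  (* The difference is mu x (lambda^p - lambda). *)
  move: (IM (sha_in (phi mu) * x) _ (Iin (phi lambda))); congr I.
  have muK : sha_in (phi mu) * sha_in (phi lambda) = 1.
    by rewrite -!rmorphM mulrC lambdaK !rmorph1.
  rewrite sha_scaleE !rmorphXn -[in _ ^+ p](subnK (prime_gt0 p_pr)) addn1 exprS.
  rewrite -[RHS]mul1r -muK; ring.
have IP x : I (x ^+ p - x) -> I (sha_baxter x ^+ p - sha_baxter x).
  move=> /IB; rewrite linearB => xI.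
  have lamI := Ilam (sha_baxter (x ^+ p)).
  (* Telescopes from P(x)^p through lambda^(p-1) P(x^p) and P(x^p) to P(x). *)
  move: (ID _ _ (Ic _ _ (sha_baxter_frobenius x)) (ID _ _ lamI xI)).
  by congr I; ring.
elim/tensor_wind => [x y|c x xI|[a s]]; first exact: IDx.
  by rewrite sha_scaleE; apply: IMx.
elim: s a => [|b s IHs] a; first exact: Iin.
by have := IMx _ _ (Iin a) (IP _ (IHs b)); rewrite -sha_tensor_cons.
Qed.

End Prime.
End Sha.

Theorem theorem4p1 (p : nat) (C : comPzRingType) (lambda : C)
    (A : comPzRingType) (phi : {rmorphism C -> A}) :
  prime p ->
  (exists mu : C, lambda * mu = 1) ->
  [/\ (forall (n : nat) (a : n.-tuple A), (1 <= n)%N ->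
         eq_modp p (sha_tensor phi lambda a ^+ p)
           (lambda ^+ ((n - 1) * (p - 1)) *:
              sha_tensor phi lambda (map_tuple (fun x => x ^+ p) a))),
      (lambda = 1 ->
       forall (n : nat) (a : n.-tuple A), (1 <= n)%N ->
         eq_modp p (sha_tensor phi lambda a ^+ p)
           (sha_tensor phi lambda (map_tuple (fun x => x ^+ p) a))),
      (let I := baxter_ideal_gen (fun x : sha phi lambda =>
                  x = p%:R \/ exists a : A, x = sha_in phi lambda (a ^+ p - a)) in
       forall x : sha phi lambda, I (x ^+ p - x))
    & (has_characteristic A p -> (forall a : A, a ^+ p = a) ->
       forall x : sha phi lambda, x ^+ p = x)].
Proof.
move=> p_pr [mu lambdaK].
have part1 n (a : n.-tuple A) : (1 <= n)%N ->
    eq_modp p (sha_tensor phi lambda a ^+ p)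
      (lambda ^+ ((n - 1) * (p - 1)) *:
         sha_tensor phi lambda (map_tuple (fun x => x ^+ p) a)).
  case: n a => // n /tupleP[a s] _; rewrite subn1 /= -[X in (X * _)%N](size_tuple s).
  exact: sha_tensor_frobenius lambdaK a s.
split=> //.
- move=> lambda1 n a /(part1 n a).
  have -> : lambda ^+ ((n - 1) * (p - 1)) = 1 by rewrite lambda1 expr1n.
  by rewrite scale1r.
- move=> I; apply: (sha_expr_baxter_ideal p_pr lambdaK).
  + exact: baxter_ideal_genP.
  + by apply: baxter_ideal_gen_sub; left.
  + by move=> a; apply: baxter_ideal_gen_sub; right; exists a.
- move=> charA Ap x; apply/eqP; rewrite -subr_eq0; apply/eqP.
  move: x; apply: (sha_expr_baxter_ideal p_pr lambdaK (I := fun x => x = 0)).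
  + split=> // [x y -> ->|r x ->|x ->]; first exact: addr0.
      exact: mulr0.
    exact: raddf0.
  (* The element p is the image of p = 0 in [A]. *)
  + by rewrite -(rmorph_nat (sha_in phi lambda)) (charA p).2 ?rmorph0.
  + by move=> a; rewrite Ap subrr raddf0.
Qed.
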